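(* Let $\mathcal{H}$ be a complex Hilbert space, let $T \in B(\mathcal{H})$, and let $N(\cdot)$ be a norm on $B(\mathcal{H})$. Then $$dw_N(T) \geq \frac12 \sqrt{N^2(T) + 2N^4(|T|) + 2\left| N^2(\Re(T)) + N^4(|T|) - N^2(\Im(T)) \right|}.$$
   Context: $B(\mathcal{H})$ is the $C^*$-algebra of bounded linear operators on the complex Hilbert space $\mathcal{H}$. For $T \in B(\mathcal{H})$, $T^*$ is the adjoint, $|T| = (T^*T)^{1/2}$, $\Re(T) = \frac12(T + T^* )$ and $\Im(T) = \frac{1}{2i}(T - T^* )$. $N(\cdot)$ is an arbitrary norm on $B(\mathcal{H})$ (as a complex vector space), not necessarily the operator norm, and $N^k(X)$ means $(N(X))^k$. The generalized Davis--Wielandt radius is $dw_N(T) = \sup_{\theta \in \mathbb{R}} \sqrt{N^2(\Re(e^{i\theta}T)) + N^4(\Re(e^{i\theta}|T|))}$. *)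

(* Defs.v *)
From HB Require Import structures.
From mathcomp Require Import all_boot all_order all_algebra.
From mathcomp Require Import complex.
From mathcomp Require Import boolp classical_sets functions reals topology.
From mathcomp Require Import normedtype trigo.

Set Implicit Arguments.
Unset Strict Implicit.
Unset Printing Implicit Defensive.

Import Order.TTheory GRing.Theory Num.Theory.
Import numFieldNormedType.Exports.
Local Open Scope classical_set_scope.
Local Open Scope ring_scope.

(* The inner product is linear in its first argument and conjugate-linear in
   the second one. *)
HB.mixin Record CompleteNormedModule_isHilbert (R : realType) H
    of CompleteNormedModule R[i] H := {
  inner : {dot H for (@Num.conj R[i])} ;
  inner_normE : forall x : H, `|x| ^+ 2 = inner x x
}.

#[short(type="hilbertType")]
HB.structure Definition Hilbert (R : realType) :=
  {H of CompleteNormedModule R[i] H & CompleteNormedModule_isHilbert R H}.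

Section BoundedOperators.
Context {R : realType} {H : hilbertType R}.

Definition bounded_operator : {pred (H -> H)} := fun f =>
  `[< linear f /\ exists M : R[i], forall x, `|f x| <= M * `|x| >].

Lemma bounded_operatorP (f : H -> H) :
  reflect (linear f /\ exists M : R[i], forall x, `|f x| <= M * `|x|)
          (f \in bounded_operator).
Proof. exact: asboolP. Qed.

Lemma bounded_operator_submod_closed : submod_closed bounded_operator.
Proof.
split.
  apply/bounded_operatorP; split=> [a x y|].
    by rewrite /= scaler0 addr0.
  by exists 0 => x; rewrite /= normr0 mul0r.
move=> a f g /bounded_operatorP[flin [Mf fM]] /bounded_operatorP[glin [Mg gM]].
apply/bounded_operatorP; split=> [b x y|].
  rewrite !fctE flin glin !scalerDr !scalerA (mulrC b a) -!addrA.
  by congr (_ + _); rewrite addrCA.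
exists (`|a| * Mf + Mg) => x; rewrite !fctE.
apply: (le_trans (ler_normD _ _)).
by rewrite normrZ mulrDl -mulrA lerD// ler_wpM2l.
Qed.

HB.instance Definition _ :=
  GRing.isSubmodClosed.Build _ _ bounded_operator bounded_operator_submod_closed.

End BoundedOperators.

Record bop (R : realType) (H : hilbertType R) := Bop {
  bop_fun :> H -> H ;
  bop_funP : bop_fun \in bounded_operator
}.

Notation "''B(' H )" := (bop H) (at level 8, format "''B(' H )").

HB.instance Definition _ (R : realType) (H : hilbertType R) :=
  [isSub for @bop_fun R H].
HB.instance Definition _ (R : realType) (H : hilbertType R) :=
  [Choice of 'B(H) by <:].
HB.instance Definition _ (R : realType) (H : hilbertType R) :=
  [SubChoice_isSubLmodule of 'B(H) by <:].

Section Operators.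
Context {R : realType} {H : hilbertType R}.
Implicit Types A B T : 'B(H).

Lemma bop_comp_subproof A B : (A \o B) \in @bounded_operator R H.
Proof.
have /bounded_operatorP[Alin [MA leA]] := bop_funP A.
have /bounded_operatorP[Blin [MB leB]] := bop_funP B.
apply/bounded_operatorP; split=> [a x y|]; first by rewrite /= Blin Alin.
exists (`|MA| * MB) => x /=; apply: (le_trans (leA _)).
have /ger0_norm <- := le_trans (normr_ge0 _) (leA (B x)).
by rewrite normrM normr_id -mulrA ler_wpM2l.
Qed.

Definition bop_comp A B : 'B(H) := Bop (bop_comp_subproof A B).

(* By the Riesz representation theorem, the set is a singleton. *)
Definition adjoint T : 'B(H) :=
  xget 0 [set S : 'B(H) | forall x y, inner (T x) y = inner x (S y)].

(* In R[i], 0 <= z means that z is real and nonnegative. *)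
Definition positive_operator A := forall x : H, 0 <= inner (A x) x.

(* If A is positive, the set is a singleton. *)
Definition sqrt_operator A : 'B(H) :=
  xget 0 [set B : 'B(H) | positive_operator B /\ bop_comp B B = A].

Definition abs_operator T : 'B(H) := sqrt_operator (bop_comp (adjoint T) T).

Definition Re_operator T : 'B(H) := 2^-1 *: (T + adjoint T).

Definition Im_operator T : 'B(H) := (2 * 'i)^-1 *: (T - adjoint T).

Record is_norm (N : 'B(H) -> R) : Prop := IsNorm {
  is_norm_triangle : forall A B, N (A + B) <= N A + N B ;
  is_norm_scale : forall (a : R[i]) A, (N (a *: A))%:C%C = `|a| * (N A)%:C%C ;
  is_norm_eq0 : forall A, N A = 0 -> A = 0
}.

Definition expi (theta : R) : R[i] := (cos theta +i* sin theta)%C.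

(* The set is bounded above for every norm N, because
   N (Re_operator (expi theta *: T)) <= (N T + N (adjoint T)) / 2. *)
Definition dw (N : 'B(H) -> R) T : R :=
  sup [set Num.sqrt (N (Re_operator (expi theta *: T)) ^+ 2
                     + N (Re_operator (expi theta *: abs_operator T)) ^+ 4)
      | theta in [set: R]].

End Operators.

(* Main.v *)
Require Import Defs.
From mathcomp Require Import all_boot all_order all_algebra.
From mathcomp Require Import complex reals.
From mathcomp Require Import boolp classical_sets trigo.
From mathcomp Require Import ring lra.

Import Order.TTheory GRing.Theory Num.Theory.
Local Open Scope ring_scope.

(** The supremum defining [dw N T] is bounded below by its values at two angles.
At angle [0] the value is [sqrt a] with [a = N(Re T)^2 + N(|T|)^4], because
[|T|] is selfadjoint and so equals its own real part. At angle [pi / 2] the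
value is at least [sqrt b] with [b = N(Im T)^2], because [Re(iT) = - Im T].
Hence
  [dw N T ^ 2 >= max(a, b) = (a + b + |a - b|) / 2].
The Cartesian decomposition [T = Re T + i Im T] and the triangle inequality give
[N(T)^2 <= 2 (N(Re T)^2 + N(Im T)^2)], that is, [a + b >= N(T)^2 / 2 + N(|T|)^4].
Inserting this in the previous bound gives the square of the claim.

Both [adjoint] and [sqrt_operator] are choices with default value [0], and each
property of them used below holds for a genuine choice and for the default
alike. The properties that matter are
[adjointZ] (the adjoint is conjugate-homogeneous), [abs_operator_selfadjoint]
(through [positive_selfadjoint], by polarization) and, since a supremum in the
real numbers bounds its set only if that set is bounded above,
[norm_Re_expi_le]. *)

Section Adjoint.
Context {R : realType} {H : hilbertType R}.
Implicit Types A B S T : 'B(H).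

Lemma bopZ (a : R[i]) A (x : H) : (a *: A) x = a *: A x. Proof. by []. Qed.

Lemma bop_ext A B : (forall x, A x = B x) -> A = B.
Proof. by move=> AB; apply/val_inj/funext. Qed.

Lemma bop_linear A : linear A.
Proof. by have /bounded_operatorP[] := bop_funP A. Qed.

Lemma bopDr A (x y : H) : A (x + y) = A x + A y.
Proof. by have := bop_linear A 1 x y; rewrite !scale1r. Qed.

Lemma bop0r A : A 0 = 0.
Proof. by apply: (addrI (A 0)); rewrite -bopDr !addr0. Qed.

Lemma bopZr A (a : R[i]) (x : H) : A (a *: x) = a *: A x.
Proof. by have := bop_linear A a x 0; rewrite bop0r !addr0. Qed.

(** A copy of [inner] whose arguments and values have the types [H] and [R[i]]
on the nose: the form structure carries them through coercions to the module
structure, which hinders rewriting. *)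
Definition dotp (x y : H) : R[i] := inner x y.

Lemma dotpC (x y : H) : dotp x y = (dotp y x)^*.
Proof. by rewrite /dotp (hermC inner) expr0 mul1r. Qed.

Lemma dotpDl (x y z : H) : dotp (x + y) z = dotp x z + dotp y z.
Proof. by rewrite /dotp linearDl. Qed.

Lemma dotpDr (x y z : H) : dotp x (y + z) = dotp x y + dotp x z.
Proof. by rewrite /dotp linearDr. Qed.

Lemma dotpZl (a : R[i]) (x y : H) : dotp (a *: x) y = a * dotp x y.
Proof. by rewrite /dotp linearZl_LR. Qed.

Lemma dotpZr (a : R[i]) (x y : H) : dotp x (a *: y) = a^* * dotp x y.
Proof. by rewrite /dotp linearZr_LR. Qed.

(** Testing against [x = u - v] gives [`|u - v| ^+ 2 = 0]. *)
Lemma dotp_injr (u v : H) : (forall x, dotp x u = dotp x v) -> u = v.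
Proof.
move=> uv; apply/eqP; rewrite -subr_eq0 -normr_eq0 -sqrf_eq0 inner_normE.
rewrite -/(dotp _ _) dotpDr uv -dotpDr subrr -(scale0r 0) dotpZr.
by rewrite rmorph0 mul0r.
Qed.

Definition adjoint_pair T S := forall x y, dotp (T x) y = dotp x (S y).

Lemma adjoint_unique T S : adjoint_pair T S -> adjoint T = S.
Proof.
move=> TS; rewrite /adjoint; case: xgetP => [S' _ TS'|noS]; last by case: (noS S).
by apply: bop_ext => y; apply: dotp_injr => x; rewrite -TS; exact/esym/TS'.
Qed.

Lemma adjoint_pairZ (a : R[i]) T S :
  adjoint_pair T S -> adjoint_pair (a *: T) (a^* *: S).
Proof. by move=> TS x y; rewrite !bopZ dotpZl dotpZr conjCK TS. Qed.

(** Multiplication by [a] and by [a^-1] transports adjoint pairs both ways, so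
[a *: T] has an adjoint exactly when [T] has one; when neither has one, both
sides are the default [0]. *)
Lemma adjointZ (a : R[i]) T : a != 0 -> adjoint (a *: T) = a^* *: adjoint T.
Proof.
move=> a0; have [[S TS]|noS] := pselect (exists S, adjoint_pair T S).
  by rewrite (adjoint_unique _ _ TS); apply/adjoint_unique/adjoint_pairZ.
rewrite [adjoint T]xgetPN ?scaler0; last by move=> S TS; apply: noS; exists S.
apply: xgetPN => S aTS; apply: noS; exists ((a^-1)^* *: S).
by have := adjoint_pairZ a^-1 _ _ aTS; rewrite scalerA mulVf// scale1r.
Qed.

(** Polarization over the complex numbers: the quadratic form of [A] is real at
[x + y] and at [x + i y], which forces [p = <Ax, y>] and [q = <Ay, x>] to
satisfy [p + q = p^* + q^*] and [p - q = q^* - p^*]; hence [p = q^*]. *)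
Lemma positive_selfadjoint A : positive_operator A -> adjoint A = A.
Proof.
move=> Apos; apply: adjoint_unique => x y.
have real u : (dotp (A u) u)^* = dotp (A u) u by apply/CrealP/ger0_real/Apos.
rewrite (dotpC x).
have := real (x + 'i *: y); have := real (x + y).
rewrite !(bopDr, bopZr, dotpDl, dotpDr, dotpZl, dotpZr, rmorphD, rmorphM).
rewrite /= !conjCK !real conjCi.
have i2 : 1 + 'i ^+ 2 = 0 :> R[i] by rewrite sqrCi subrr.
move: (dotp (A x) x) (dotp (A y) y) (dotp (A x) y) (dotp (A y) x) => r s p q.
move: (p^*) (q^*) => p' q' e1 e2.
(* Here [p'] and [q'] stand for [p^*] and [q^*]. The combination [e1 + 'i * e2]
   isolates [q' - p]; the last summand accounts for [ring] treating ['i] as an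
   indeterminate. *)
have : 2 * (q' - p) = 0.
  have -> : 2 * (q' - p) =
      (r + q' + (p' + s) - (r + q + (p + s)))
      + 'i * (r + - 'i * q' + ('i * p' + - 'i * ('i * s))
              - (r + 'i * q + (- 'i * p + 'i * (- 'i * s))))
      + (1 + 'i ^+ 2) * (q' - p' + q - p) by ring.
  by rewrite e1 e2 i2 !subrr mulr0 mul0r !addr0.
by move/eqP; rewrite mulf_eq0 pnatr_eq0 subr_eq0 => /eqP.
Qed.

(** If no positive square root exists, [abs_operator T] is the zero operator,
which is positive as well. *)
Lemma abs_operator_selfadjoint T : adjoint (abs_operator T) = abs_operator T.
Proof.
apply: positive_selfadjoint; rewrite /abs_operator /sqrt_operator.
case: xgetP => [B _ []//|_] x.
have zeroE : (0 : 'B(H)) x = 0 *: x by rewrite scale0r.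
by rewrite -/(dotp _ _) zeroE dotpZl mul0r.
Qed.

Lemma half_double A : 2^-1 *: (A + A) = A.
Proof.
rewrite -{1 2}(scale1r A) -scalerDl scalerA.
rewrite mulVf ?scale1r//.
by rewrite pnatr_eq0.
Qed.

Lemma Re_operator_selfadjoint A : adjoint A = A -> Re_operator A = A.
Proof.
by rewrite /Re_operator => ->; apply: half_double.
Qed.

Lemma Cartesian_decomposition T : T = Re_operator T + 'i *: Im_operator T.
Proof.
rewrite /Re_operator /Im_operator scalerA invfM mulrCA divff ?neq0Ci// mulr1.
by rewrite -scalerDr addrACA subrr addr0 half_double.
Qed.

Lemma Re_operator_i T : Re_operator ('i *: T) = - Im_operator T.
Proof.
rewrite /Re_operator /Im_operator adjointZ ?neq0Ci// conjCi scaleNr -scalerBr.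
by rewrite scalerA invfM invCi mulrN scaleNr opprK.
Qed.

Lemma normr_expi (theta : R) : `|expi theta| = 1.
Proof. by rewrite normc_def /= cos2Dsin2 sqrtr1. Qed.

Lemma expi0 : expi 0 = 1 :> R[i].
Proof. by rewrite /expi cos0 sin0. Qed.

Lemma expi_pihalf : expi (pi / 2) = 'i :> R[i].
Proof. by rewrite /expi cos_pihalf sin_pihalf -complexiE. Qed.

End Adjoint.

Section Norm.
Context {R : realType} {H : hilbertType R} {N : 'B(H) -> R} (N_norm : is_norm N).
Implicit Types A B T : 'B(H).

Lemma is_normZ (a : R[i]) (r : R) A : `|a| = r%:C%C -> N (a *: A) = r * N A.
Proof. by move=> ar; apply: complexI; rewrite is_norm_scale// ar rmorphM. Qed.

Lemma is_norm_phase (a : R[i]) A : `|a| = 1 -> N (a *: A) = N A.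
Proof. by move=> a1; rewrite (is_normZ _ 1) ?mul1r// a1. Qed.

Lemma is_normN A : N (- A) = N A.
Proof. by rewrite -scaleN1r is_norm_phase// normrN1. Qed.

(** Nonnegativity follows from [0 = N (A - A) <= N A + N (- A)]. *)
Lemma is_norm_ge0 A : 0 <= N A.
Proof.
have N0 : N 0 = 0 by rewrite -(scale0r 0) (is_normZ _ 0) ?mul0r// normr0.
by have := is_norm_triangle N_norm A (- A); rewrite subrr N0 is_normN; lra.
Qed.

(** A bound independent of [theta], which makes the supremum in [dw]
meaningful. *)
Lemma norm_Re_expi_le T (theta : R) :
  N (Re_operator (expi theta *: T)) <= 2^-1 * (N T + N (adjoint T)).
Proof.
have half : `|2^-1 : R[i]| = (2^-1)%:C%C.
  by rewrite ger0_norm ?invr_ge0// fmorphV rmorph_nat.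
have e0 : expi theta != 0 by rewrite -normr_eq0 normr_expi oner_eq0.
rewrite /Re_operator (is_normZ _ _ _ half) ler_wpM2l ?invr_ge0// adjointZ//.
apply: le_trans (is_norm_triangle N_norm _ _) _.
by rewrite !is_norm_phase ?norm_conjC ?normr_expi.
Qed.

Lemma dw_ge T (theta : R) :
  Num.sqrt (N (Re_operator (expi theta *: T)) ^+ 2
            + N (Re_operator (expi theta *: abs_operator T)) ^+ 4) <= dw N T.
Proof.
apply: ub_le_sup; last by exists theta.
pose c A := 2^-1 * (N A + N (adjoint A)).
exists (Num.sqrt (c T ^+ 2 + c (abs_operator T) ^+ 4)) => _ [t _ <-].
apply: ler_wsqrtr; apply: lerD; apply: lerXn2r;
  by rewrite ?nnegrE ?mulr_ge0 ?invr_ge0 ?addr_ge0 ?is_norm_ge0 ?norm_Re_expi_le.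
Qed.

Lemma dw_ge0 T : 0 <= dw N T.
Proof. exact: le_trans (sqrtr_ge0 _) (dw_ge T 0). Qed.

Lemma dw2_ge_Re T :
  N (Re_operator T) ^+ 2 + N (abs_operator T) ^+ 4 <= dw N T ^+ 2.
Proof.
have := dw_ge T 0; rewrite expi0 !scale1r.
rewrite (Re_operator_selfadjoint (abs_operator T)); last first.
  exact: abs_operator_selfadjoint.
rewrite -(ler_pXn2r (ltn0Sn 1)) ?nnegrE ?sqrtr_ge0 ?dw_ge0// sqr_sqrtr//.
by rewrite addr_ge0 ?exprn_ge0 ?is_norm_ge0.
Qed.

(** Evaluation at [pi / 2], where [Re_operator ('i *: abs_operator T)]
contributes only a nonnegative term. *)
Lemma dw2_ge_Im T : N (Im_operator T) ^+ 2 <= dw N T ^+ 2.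
Proof.
have := dw_ge T (pi / 2); rewrite expi_pihalf Re_operator_i is_normN.
rewrite -(ler_pXn2r (ltn0Sn 1)) ?nnegrE ?sqrtr_ge0 ?dw_ge0// sqr_sqrtr.
  by apply: le_trans; rewrite lerDl exprn_ge0 ?is_norm_ge0.
by rewrite addr_ge0 ?exprn_ge0 ?is_norm_ge0.
Qed.

Lemma norm2_le_Cartesian T :
  N T ^+ 2 <= 2 * (N (Re_operator T) ^+ 2 + N (Im_operator T) ^+ 2).
Proof.
have le_sum : N T <= N (Re_operator T) + N (Im_operator T).
  rewrite {1}(Cartesian_decomposition T).
  apply: le_trans (is_norm_triangle N_norm _ _) _.
  by rewrite (is_norm_phase _ _ (normCi _)) lexx.
have := is_norm_ge0 T; have := sqr_ge0 (N (Re_operator T) - N (Im_operator T)).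
nra.
Qed.

End Norm.

Theorem theorem2 (R : realType) (H : hilbertType R) (N : 'B(H) -> R)
    (N_norm : is_norm N) (T : 'B(H)) :
  dw N T >=
    2^-1 * Num.sqrt (N T ^+ 2 + 2 * N (abs_operator T) ^+ 4
      + 2 * `|N (Re_operator T) ^+ 2 + N (abs_operator T) ^+ 4
              - N (Im_operator T) ^+ 2|).
Proof.
have d0 := dw_ge0 N_norm T.
have a_le := dw2_ge_Re N_norm T; have b_le := dw2_ge_Im N_norm T.
have T_le := norm2_le_Cartesian N_norm T.
rewrite mulrC ler_pdivrMr// -[leRHS]ger0_norm ?mulr_ge0// -[leRHS]sqrtr_sqr.
apply: ler_wsqrtr.
(* By [T_le] it is enough that [(a + b + `|a - b|) / 2 <= dw N T ^+ 2], whose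
   left-hand side is [a] or [b] according to the sign of [a - b]. *)
case: (lerP (N (Im_operator T) ^+ 2)
  (N (Re_operator T) ^+ 2 + N (abs_operator T) ^+ 4)) => _; lra.
Qed.
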